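(* Let $\mathcal{X}$ and $\mathcal{Y}$ be two finite nonempty sets. The space $\mathrm{DMC}_{\mathcal{X},\mathcal{Y}}^{(o)}$ of equivalence classes of channels from $\mathcal{X}$ to $\mathcal{Y}$, endowed with the quotient topology $\mathcal{T}_{\mathcal{X},\mathcal{Y}}^{(o)}$, is compact, path-connected and metrizable.
   Context: For finite nonempty sets $\mathcal{X},\mathcal{Y}$, $\mathrm{DMC}_{\mathcal{X},\mathcal{Y}}$ is the set of channels from $\mathcal{X}$ to $\mathcal{Y}$, i.e. functions $W:\mathcal{X}\times\mathcal{Y}\to[0,1]$, written $W(y|x)$, with $\sum_{y\in\mathcal{Y}}W(y|x)=1$ for every $x\in\mathcal{X}$. It carries the topology inherited from the Euclidean topology of $\mathbb{R}^{\mathcal{X}\times\mathcal{Y}}$. For $W\in\mathrm{DMC}_{\mathcal{X},\mathcal{Y}}$ and $V\in\mathrm{DMC}_{\mathcal{Y},\mathcal{Z}}$, the composition $V\circ W\in\mathrm{DMC}_{\mathcal{X},\mathcal{Z}}$ is $(V\circ W)(z|x)=\sum_{y\in\mathcal{Y}}V(z|y)W(y|x)$. A channel $W'\in\mathrm{DMC}_{\mathcal{X},\mathcal{Z}}$ is degraded from $W\in\mathrm{DMC}_{\mathcal{X},\mathcal{Y}}$ if $W'=V\circ W$ for some $V\in\mathrm{DMC}_{\mathcal{Y},\mathcal{Z}}$; $W$ and $W'$ are equivalent if each is degraded from the other. $\mathrm{DMC}_{\mathcal{X},\mathcal{Y}}^{(o)}$ is the quotient of $\mathrm{DMC}_{\mathcal{X},\mathcal{Y}}$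 by this equivalence relation, and $\mathcal{T}_{\mathcal{X},\mathcal{Y}}^{(o)}$ is the quotient topology. *)

(* Defs.v *)
From HB Require Import structures.
From mathcomp Require Import all_boot all_order all_algebra generic_quotient.
From mathcomp Require Import all_classical all_reals all_analysis.

Set Implicit Arguments.
Unset Strict Implicit.
Unset Printing Implicit Defensive.

Import Order.TTheory GRing.Theory Num.Theory.
Import numFieldNormedType.Exports.

Local Open Scope classical_set_scope.
Local Open Scope ring_scope.
Local Open Scope quotient_scope.

Section Channels.
Variable R : realType.

(* [W (x, y)] is W(y|x). The set lives in [{ptws X * Y -> R}], the finite
   product of copies of R, whose topology is the Euclidean one. *)
Definition is_channel (X Y : finType) : set {ptws X * Y -> R} :=
  [set W | (forall x y, 0 <= W (x, y) <= 1) /\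
           (forall x, \sum_(y : Y) W (x, y) = 1)].

Arguments is_channel : clear implicits.

(* Coerced to a type, a set carries the subset topology. *)
Definition DMC (X Y : finType) : Type := is_channel X Y.
HB.instance Definition _ X Y := Topological.copy (DMC X Y) (is_channel X Y).

Definition transition X Y (W : DMC X Y) : X * Y -> R := set_val W.

Lemma transition_ge0 X Y (W : DMC X Y) x y : 0 <= transition W (x, y).
Proof. by have [/(_ x y)/andP[+ _] _] := set_valP W. Qed.

Lemma transition_sum X Y (W : DMC X Y) x : \sum_y transition W (x, y) = 1.
Proof. by have [_ /(_ x)] := set_valP W. Qed.

Lemma is_channelP (X Y : finType) (W : {ptws X * Y -> R}) :
  (forall x y, 0 <= W (x, y)) -> (forall x, \sum_y W (x, y) = 1) ->
  is_channel X Y W.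
Proof.
move=> W0 W1; split=> // x y; rewrite W0 -(W1 x) (bigD1 y)//= lerDl.
exact: sumr_ge0.
Qed.

Lemma transition_inj X Y : injective (@transition X Y).
Proof. by move=> V W; exact: val_inj. Qed.

Definition compose_fun X Y Z (V : DMC Y Z) (W : DMC X Y) :
    {ptws X * Z -> R} :=
  fun p => \sum_(y : Y) transition V (y, p.2) * transition W (p.1, y).

Lemma compose_channel X Y Z (V : DMC Y Z) (W : DMC X Y) :
  is_channel X Z (compose_fun V W).
Proof.
apply: is_channelP => [x z|x]; rewrite /compose_fun/=.
  by apply: sumr_ge0 => y _; rewrite mulr_ge0 ?transition_ge0.
rewrite exchange_big/= -(transition_sum W x); apply: eq_bigr => y _.
by rewrite -mulr_suml transition_sum mul1r.
Qed.

Definition compose X Y Z (V : DMC Y Z) (W : DMC X Y) : DMC X Z :=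
  SigSub (mem_set (compose_channel V W)).

Lemma transition_compose X Y Z (V : DMC Y Z) (W : DMC X Y) x z :
  transition (compose V W) (x, z) =
  \sum_(y : Y) transition V (y, z) * transition W (x, y).
Proof. by rewrite /transition set_valE. Qed.

Definition degraded X Y Z (W' : DMC X Z) (W : DMC X Y) : Prop :=
  exists V : DMC Y Z, W' = compose V W.

Definition equivalent X Y Z (W : DMC X Y) (W' : DMC X Z) : Prop :=
  degraded W W' /\ degraded W' W.

Lemma id_channelP Y : is_channel Y Y (fun p => (p.1 == p.2)%:R).
Proof.
apply: is_channelP => [//|x] /=.
by rewrite (bigD1 x)//= eqxx big1 ?addr0// => y; rewrite eq_sym => /negPf->.
Qed.

Definition id_channel Y : DMC Y Y := SigSub (mem_set (@id_channelP Y)).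

Lemma transition_id (Y : finType) (x y : Y) :
  transition (id_channel Y) (x, y) = (x == y)%:R.
Proof. by rewrite /transition set_valE. Qed.

Lemma degraded_refl X Y (W : DMC X Y) : degraded W W.
Proof.
exists (id_channel Y); apply: transition_inj; apply/funext => -[x y].
rewrite transition_compose (bigD1 y)//= transition_id eqxx mul1r.
by rewrite big1 ?addr0// => z /negPf zy; rewrite transition_id zy mul0r.
Qed.

Lemma degraded_trans X Y Z T (W1 : DMC X Y) (W2 : DMC X Z) (W3 : DMC X T) :
  degraded W1 W2 -> degraded W2 W3 -> degraded W1 W3.
Proof.
move=> [V ->] [U ->]; exists (compose V U); apply: transition_inj.
apply/funext => -[x y]; rewrite !transition_compose.
under eq_bigr do rewrite transition_compose mulr_sumr.
rewrite exchange_big/=; apply: eq_bigr => t _.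
rewrite transition_compose mulr_suml.
by apply: eq_bigr => z _; rewrite mulrA.
Qed.

Section Quotient.
Variables X Y : finType.

Definition equivalentb (W W' : DMC X Y) : bool := `[< equivalent W W' >].

Lemma equivalentb_refl : reflexive equivalentb.
Proof. by move=> W; apply/asboolP; split; exact: degraded_refl. Qed.

Lemma equivalentb_sym : symmetric equivalentb.
Proof. by move=> W W'; apply/asboolP/asboolP => -[]. Qed.

Lemma equivalentb_trans : transitive equivalentb.
Proof.
move=> W2 W1 W3 /asboolP[d21 d12] /asboolP[d32 d23]; apply/asboolP.
by split; apply: degraded_trans; eassumption.
Qed.

Definition channel_equiv :=
  EquivRel equivalentb equivalentb_refl equivalentb_sym equivalentb_trans.

Definition DMCo : Type := quotient_topology {eq_quot channel_equiv}.
HB.instance Definition _ :=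
  Topological.copy DMCo (quotient_topology {eq_quot channel_equiv}).

HB.instance Definition _ := Quotient.on DMCo.

End Quotient.
End Channels.

Definition path_connected (R : realType) (T : topologicalType) : Prop :=
  forall a b : T, exists f : R -> T,
    [/\ {within `[0, 1]%classic, continuous f}, f 0 = a & f 1 = b].

Definition metrizable (R : realType) (T : topologicalType) : Prop :=
  exists (M : metricType R) (f : T -> M) (g : M -> T),
    [/\ cancel f g, cancel g f, continuous f & continuous g].

(* Main.v *)
(* The quotient is a continuous image of a compact convex set, hence compact and
   path-connected. The metric is Le Cam's: the deficiency of W with respect to W'
   is the least l1 distance from W' to a degradation V o W of W. The minimum is
   attained by compactness, so the deficiency vanishes exactly when W' is
   degraded from W; and it satisfies the triangle inequality because composing
   with a channel is a contraction for the l1 distance. The symmetrised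
   deficiency is dominated by the l1 distance, so the identity from the quotient
   topology to the metric one is a continuous bijection from a compact space to
   a Hausdorff space, that is, a homeomorphism. *)
From HB Require Import structures.
Require Import Defs.
From mathcomp Require Import all_boot all_order all_algebra.
From mathcomp Require Import all_classical all_reals all_analysis.

Local Open Scope classical_set_scope.

Set Implicit Arguments.
Unset Strict Implicit.
Import Order.TTheory GRing.Theory Num.Theory.
Import numFieldNormedType.Exports.

(** * General topology: compactness and continuity *)

Lemma compact_set_type (T : topologicalType) (A : set T) :
  compact A -> compact [set: A].
Proof.
(* Push the filter forward along [set_val]: a cluster point of the image in [A] is one of [F], since
   opens of the subset topology are preimages. *)
move=> cA F PF _; pose G : set_system T := set_val @ F.
have [|p [Ap Gp]] := cA G (fmap_proper_filter _ PF).
  by apply: (@filterE _ F) => x; exact: set_valP.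
exists (SigSub (mem_set Ap)); split=> // B C FB [_ [[U oU <-] Up UC]].
have [| |_ [[x Bx <-] Ux]] := Gp (set_val @` B) U.
- by apply: (@filterS _ F _ B) FB => x Bx /=; exists x.
- exact: open_nbhs_nbhs.
- by exists x; split=> //; apply: UC.
Qed.

(** A closed subset of a compact space is compact, so its image under [f] is compact, hence closed
    in the Hausdorff space; that image is the preimage under [g]. *)
Lemma compact_homeomorphism (T U : topologicalType) (f : T -> U) (g : U -> T) :
  compact [set: T] -> hausdorff_space U -> continuous f ->
  cancel f g -> cancel g f -> continuous g.
Proof.
move=> cT hU cf fK gK; apply/continuous_closedP => C cC.
have -> : g @^-1` C = f @` C.
  by apply/seteqP; split=> [u Cu|_ [t Ct <-]]/=; [exists (g u)|rewrite fK].
apply: compact_closed => //; apply: continuous_compact.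
  exact: continuous_subspaceT.
exact: subclosed_compact cT _.
Qed.

Lemma continuous_sum (R : realType) (T : topologicalType) (I : finType)
    (F : I -> T -> R) :
  (forall i, continuous (F i)) -> continuous (fun t => \sum_i F i t)%R.
Proof.
move=> cF t; apply: cvg_big => [|i _]; last exact: cF.
exact: add_continuous.
Qed.

Lemma continuous_normB (R : realType) (T : topologicalType) (f : T -> R) c :
  continuous f -> continuous (fun t => `|f t - c|%R).
Proof. by move=> cf t; apply: cvg_norm; apply: cvgB (cf t) (cvg_cst _). Qed.

Lemma continuous_mdist_le (R : realType) (T : topologicalType)
    (M : metricType R) (f : T -> M) (g : T -> T -> R) :
  (forall t, continuous (g t)) -> (forall t, g t t = 0)%R ->
  (forall s t, mdist (f s) (f t) <= g s t)%R -> continuous f.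
Proof.
move=> cg g0 fg t; apply/metricType_numDomainType.cvgrPdist_lt => e e0.
have /cvgr_lt/(_ e) := cg t t; rewrite g0 => /(_ e0).
by apply: filterS => s; exact: le_lt_trans.
Qed.

Section Channels.
Local Open Scope ring_scope.
Local Open Scope quotient_scope.
Context {R : realType}.

(** * The space of channels and its l1 distance *)

Section Topology.
Variables X Y : finType.

Lemma transition_continuous (p : X * Y) :
  continuous (fun W : DMC R X Y => transition W p).
Proof.
move=> W.
apply: (@continuous_comp (DMC R X Y) {ptws X * Y -> R} R set_val (fun f => f p)).
  exact: initial_continuous.
exact: (@proj_continuous _ (fun=> R) p).
Qed.

Lemma DMC_continuous (T : topologicalType) (f : T -> DMC R X Y) :
  (forall p, continuous (fun t => transition (f t) p)) -> continuous f.
Proof.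
move=> cf; apply: (@continuous_comp_initial (DMC R X Y) T _ set_val f).
(* The product topology is the supremum of those induced by the evaluations, so each [p] is treated
   separately on preimages of opens. *)
move=> t; apply/cvg_sup => p U [_ [[V oV <-] Vt /filterS]]; apply.
exact/(cf p)/open_nbhs_nbhs.
Qed.

(** The bounds cut out a cube, compact by Tychonoff; each row-sum equation is a closed condition. *)
Lemma is_channel_compact : compact (@is_channel R X Y).
Proof.
rewrite (_ : @is_channel R X Y = [set W | forall p, `[0, 1]%classic (W p)] `&`
    \bigcap_(x in [set: X])
      (fun W : {ptws X * Y -> R} => \sum_y W (x, y)) @^-1` [set 1]).
  apply: compact_closedI.
    apply: (@tychonoff _ (fun=> R) (fun=> `[0, 1]%classic)) => p.
    exact: segment_compact.
  apply: closed_bigI => x _.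
  have /continuous_closedP : continuous
      (fun W : {ptws X * Y -> R} => \sum_y W (x, y)).
    apply: continuous_sum => y; exact: (@proj_continuous _ (fun=> R) (x, y)).
  by apply; exact: closed_eq.
apply/seteqP; split=> W [W01 W1]; split.
- by case=> x y; rewrite /= in_itv/=; exact: W01.
- by move=> x _; exact: W1.
- by move=> x y; have := W01 (x, y); rewrite /= in_itv.
- by move=> x; have := W1 x I.
Qed.

Lemma DMC_compact : compact [set: DMC R X Y].
Proof. exact/compact_set_type/is_channel_compact. Qed.

Definition l1dist (V W : DMC R X Y) : R :=
  \sum_p `|transition V p - transition W p|.

Lemma l1distE V W :
  l1dist V W = \sum_x \sum_y `|transition V (x, y) - transition W (x, y)|.
Proof. by rewrite pair_bigA; apply: eq_bigr => -[]. Qed.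

Lemma l1dist_ge0 V W : 0 <= l1dist V W.
Proof. exact: sumr_ge0. Qed.

Lemma l1distxx W : l1dist W W = 0.
Proof. by apply: big1 => p _; rewrite subrr normr0. Qed.

Lemma l1dist_eq0 V W : l1dist V W = 0 -> V = W.
Proof.
move=> /eqP; rewrite psumr_eq0// => /allP VW; apply: transition_inj.
apply/funext => p; apply/eqP; rewrite -subr_eq0 -normr_eq0.
exact/VW/mem_index_enum.
Qed.

Lemma l1dist_triangle U V W : l1dist U W <= l1dist U V + l1dist V W.
Proof. by rewrite -big_split; apply: ler_sum => p _; exact: ler_distD. Qed.

Lemma l1distC V W : l1dist V W = l1dist W V.
Proof. by apply: eq_bigr => p _; rewrite distrC. Qed.

Lemma l1dist_continuous W : continuous (fun V => l1dist V W).
Proof.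
apply: continuous_sum => p; apply: continuous_normB.
exact: transition_continuous.
Qed.

End Topology.

(** * Composition of channels *)

Lemma compose_id (X Y : finType) (W : DMC R X Y) :
  compose (id_channel R Y) W = W.
Proof.
apply: transition_inj; apply/funext => -[x y].
rewrite transition_compose (bigD1 y)//= transition_id eqxx mul1r.
by rewrite big1 ?addr0// => z /negPf zy; rewrite transition_id zy mul0r.
Qed.

Lemma composeA (X Y Z T : finType) (U : DMC R Z T) (V : DMC R Y Z)
    (W : DMC R X Y) :
  compose U (compose V W) = compose (compose U V) W.
Proof.
apply: transition_inj; apply/funext => -[x t]; rewrite !transition_compose.
under eq_bigr do rewrite transition_compose mulr_sumr.
rewrite exchange_big/=; apply: eq_bigr => y _.
rewrite transition_compose mulr_suml.
by apply: eq_bigr => z _; rewrite mulrA.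
Qed.

Lemma compose_continuous (X Y Z : finType) (W : DMC R X Y) :
  continuous (fun V : DMC R Y Z => compose V W).
Proof.
apply: DMC_continuous => -[x z].
rewrite (funext (fun V => transition_compose V W x z)).
apply: continuous_sum => y V; apply: continuousM; last exact: cst_continuous.
exact: transition_continuous.
Qed.

(** After the triangle inequality and an exchange of sums, each row of [V] contributes a total
    weight of 1. *)
Lemma l1dist_compose (X Y Z : finType) (V : DMC R Y Z) (W W' : DMC R X Y) :
  l1dist (compose V W) (compose V W') <= l1dist W W'.
Proof.
rewrite !l1distE; apply: ler_sum => x _.
rewrite (@le_trans _ _ (\sum_z \sum_y
    transition V (y, z) * `|transition W (x, y) - transition W' (x, y)|))//.
  apply: ler_sum => z _; rewrite !transition_compose -sumrB.
  apply: le_trans (ler_norm_sum _ _ _) _; apply: ler_sum => y _.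
  by rewrite -mulrBr normrM ger0_norm// transition_ge0.
rewrite exchange_big/=; apply: ler_sum => y _.
by rewrite -mulr_suml transition_sum mul1r.
Qed.

(** * Deficiency as a minimum over degradations *)

Definition deficiency (X Y Z : finType) (W : DMC R X Y) (W' : DMC R X Z) : R :=
  inf (range (fun V : DMC R Y Z => l1dist (compose V W) W')).

Section Deficiency.
Variables X Y Z : finType.
Implicit Types (W : DMC R X Y) (U : DMC R X Z) (V : DMC R Y Z).

Lemma deficiency_le V W U : deficiency W U <= l1dist (compose V W) U.
Proof.
apply: ge_inf; last by exists V.
by exists 0 => _ [A _ <-]; exact: l1dist_ge0.
Qed.

(* [V0] only witnesses that there are channels from Y to Z. *)
Lemma deficiency_attained W U (V0 : DMC R Y Z) :
  exists V, deficiency W U = l1dist (compose V W) U.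
Proof.
have cl : {within [set: DMC R Y Z],
    continuous (fun V => l1dist (compose V W) U)}.
  apply: continuous_subspaceT => V.
  exact: continuous_comp (@compose_continuous _ _ _ W V)
    (@l1dist_continuous _ _ U _).
have [|V _ Vmin] := compact_EVT_min _ (@DMC_compact Y Z) cl; first by exists V0.
exists V; apply/le_anti; rewrite deficiency_le/=.
apply: lb_le_inf; first by exists (l1dist (compose V W) U), V.
by move=> _ [A _ <-]; apply: Vmin; rewrite inE.
Qed.

End Deficiency.

(** * The symmetrised deficiency as a pseudometric on channels *)

Section DeficiencyMetric.
Variables X Y : finType.
Implicit Types U V W : DMC R X Y.

Lemma deficiency_ge0 V W : 0 <= deficiency V W.
Proof.
by have [U ->] := deficiency_attained V W (id_channel R Y); exact: l1dist_ge0.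
Qed.

Lemma deficiency_le_l1dist V W : deficiency V W <= l1dist V W.
Proof.
apply: le_trans (deficiency_le (id_channel R Y) V W) _.
by rewrite compose_id.
Qed.

Lemma deficiency_eq0 V W : deficiency V W = 0 <-> degraded W V.
Proof.
split=> [|[U ->]].
  have [U ->] := deficiency_attained V W (id_channel R Y).
  by move/l1dist_eq0 => <-; exists U.
apply/le_anti; rewrite deficiency_ge0 andbT.
by rewrite -(l1distxx (compose U V)) deficiency_le.
Qed.

Lemma deficiency_triangle V U W :
  deficiency U W <= deficiency U V + deficiency V W.
Proof.
have [A ->] := deficiency_attained U V (id_channel R Y).
have [B ->] := deficiency_attained V W (id_channel R Y).
(* Degrade [U] by [A], then by [B]. Passing through [compose B V], the first leg is bounded by
   contraction under [B]. *)
apply: le_trans (deficiency_le (compose B A) U W) _; rewrite -composeA.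
apply: le_trans (l1dist_triangle _ (compose B V) _) _.
by rewrite lerD2r; exact: l1dist_compose.
Qed.

Definition le_cam V W := deficiency V W + deficiency W V.

Lemma le_cam_le_l1dist V W : le_cam V W <= l1dist V W + l1dist V W.
Proof.
by rewrite lerD ?deficiency_le_l1dist// l1distC deficiency_le_l1dist.
Qed.

Lemma le_camC V W : le_cam V W = le_cam W V.
Proof. exact: addrC. Qed.

Lemma le_cam_triangle V U W : le_cam U W <= le_cam U V + le_cam V W.
Proof.
by rewrite addrACA (addrC (deficiency V U)) lerD// deficiency_triangle.
Qed.

Lemma le_cam_eq0 V W : le_cam V W = 0 <-> equivalent V W.
Proof.
split=> [/eqP|[/deficiency_eq0 WV /deficiency_eq0 VW]]; last first.
  by rewrite /le_cam WV VW addr0.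
rewrite paddr_eq0 ?deficiency_ge0// => /andP[/eqP/deficiency_eq0 WV].
by move=> /eqP/deficiency_eq0 VW.
Qed.

Lemma le_camxx W : le_cam W W = 0.
Proof. by apply/le_cam_eq0; split; exact: degraded_refl. Qed.

(** Makes the distance descend to the quotient: by the triangle inequality, moving to an equivalent
    channel costs 0. *)
Lemma le_cam_equivalent V V' W W' :
  equivalent V V' -> equivalent W W' -> le_cam V W = le_cam V' W'.
Proof.
have le A A' B B' :
    equivalent A A' -> equivalent B B' -> le_cam A B <= le_cam A' B'.
  move=> /le_cam_eq0 AA' /le_cam_eq0; rewrite le_camC => BB'.
  apply: le_trans (le_cam_triangle A' _ _) _; rewrite AA' add0r.
  by apply: le_trans (le_cam_triangle B' _ _) _; rewrite BB' addr0.
move=> VV' WW'; apply/le_anti; rewrite le//= le//.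
  by case: VV'.
by case: WW'.
Qed.

End DeficiencyMetric.

(** * The metric on equivalence classes, and metrizability *)

Section MetricQuotient.
Variables X Y : finType.

(* An alias that drops the quotient topology, so that the one derived from the
   metric does not clash with it. *)
Definition le_cam_space : Type := DMCo R X Y.

HB.instance Definition _ := Choice.copy le_cam_space (DMCo R X Y).

(** By [le_cam_equivalent], the value does not depend on the representatives. *)
Definition le_cam_quot (a b : le_cam_space) : R :=
  le_cam (repr (a : DMCo R X Y)) (repr (b : DMCo R X Y)).

Lemma equivalent_pi (V W : DMC R X Y) :
  \pi_(DMCo R X Y) V = \pi_(DMCo R X Y) W <-> equivalent V W.
Proof.
by split=> [/(@eqmodP _ (channel_equiv R X Y))/asboolP//|VW];
  apply/(@eqmodP _ (channel_equiv R X Y))/asboolP.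
Qed.

Lemma equivalent_repr_pi (W : DMC R X Y) :
  equivalent (repr (\pi_(DMCo R X Y) W)) W.
Proof. by apply/equivalent_pi; rewrite reprK. Qed.

Lemma le_cam_quotxx a : le_cam_quot a a = 0.
Proof. exact: le_camxx. Qed.

Lemma le_cam_quot_eq0 a b : le_cam_quot a b = 0 -> a = b.
Proof. by move=> /le_cam_eq0/equivalent_pi; rewrite !reprK. Qed.

Lemma le_cam_quotC a b : le_cam_quot a b = le_cam_quot b a.
Proof. exact: le_camC. Qed.

Lemma le_cam_quot_triangle b a c :
  le_cam_quot a c <= le_cam_quot a b + le_cam_quot b c.
Proof. exact: le_cam_triangle. Qed.

HB.instance Definition _ := isMetric.Build R le_cam_space
  le_cam_quotxx le_cam_quot_eq0 le_cam_quotC le_cam_quot_triangle.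

Lemma pi_le_cam_continuous :
  continuous (\pi_(DMCo R X Y) : DMC R X Y -> le_cam_space).
Proof.
(* The arguments of [l1dist] are swapped: the bound must be continuous in its second variable, while
   [l1dist_continuous] concerns the first argument. *)
apply: (@continuous_mdist_le _ _ _ _ (fun V W => l1dist W V + l1dist W V)).
- move=> V W.
  exact: cvgD (@l1dist_continuous X Y V W) (@l1dist_continuous X Y V W).
- by move=> V; rewrite l1distxx addr0.
move=> V W; rewrite /mdist/= /le_cam_quot.
rewrite (le_cam_equivalent (equivalent_repr_pi _) (equivalent_repr_pi _)).
by rewrite le_camC; exact: le_cam_le_l1dist.
Qed.

(** Universal property of the quotient topology. *)
Lemma le_cam_space_continuous :
  continuous (idfun : DMCo R X Y -> le_cam_space).
Proof. by apply/quotient_continuous; exact: pi_le_cam_continuous. Qed.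

Lemma DMCo_compact : compact [set: DMCo R X Y].
Proof.
have -> : [set: DMCo R X Y] = \pi_(DMCo R X Y) @` [set: DMC R X Y].
  by apply/seteqP; split=> [a _|//]; exists (repr a) => //; rewrite reprK.
apply: continuous_compact (@DMC_compact X Y).
apply: continuous_subspaceT; exact: pi_continuous.
Qed.

Lemma DMCo_metrizable : metrizable R (DMCo R X Y).
Proof.
(* Both maps are the identity on classes; only the topologies differ. *)
exists le_cam_space, idfun, idfun; split=> //; first exact: le_cam_space_continuous.
exact: (compact_homeomorphism DMCo_compact (@metric_hausdorff _ _)
  le_cam_space_continuous).
Qed.

End MetricQuotient.

(** * Convex combinations of channels, and path-connectedness *)

Section Mixture.
Variables (X Y : finType) (V W : DMC R X Y).

(* Clamping to [0, 1] makes the segment from V to W defined on all of R. *)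
Definition clamp (t : R) := Num.max 0 (Num.min t 1).

Lemma clamp_itv t : 0 <= clamp t <= 1.
Proof. by rewrite /clamp le_max lexx/= ge_max ler01 ge_min lexx orbT. Qed.

Lemma clamp_continuous : continuous clamp.
Proof.
have -> : clamp = (cst 0 \max (id \min cst 1)) by [].
move=> t; apply: continuous_max; first exact: cst_continuous.
by apply: continuous_min; [exact: id|exact: cst_continuous].
Qed.

Definition mixture_fun (t : R) : {ptws X * Y -> R} :=
  fun p => (1 - clamp t) * transition V p + clamp t * transition W p.

Lemma mixture_channel t : is_channel (mixture_fun t).
Proof.
have /andP[t0 t1] := clamp_itv t; apply: is_channelP => [x y|x].
  by rewrite addr_ge0// mulr_ge0 ?subr_ge0 ?transition_ge0.
by rewrite big_split/= -!mulr_sumr !transition_sum !mulr1 subrK.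
Qed.

Definition mixture t : DMC R X Y := SigSub (mem_set (mixture_channel t)).

Lemma transition_mixture t p : transition (mixture t) p =
  (1 - clamp t) * transition V p + clamp t * transition W p.
Proof. by rewrite /transition set_valE. Qed.

Lemma mixture0 : mixture 0 = V.
Proof.
apply: transition_inj; apply/funext => p; rewrite transition_mixture.
by rewrite /clamp min_l// maxxx subr0 mul1r mul0r addr0.
Qed.

Lemma mixture1 : mixture 1 = W.
Proof.
apply: transition_inj; apply/funext => p; rewrite transition_mixture.
by rewrite /clamp minxx max_r// subrr mul1r mul0r add0r.
Qed.

Lemma mixture_continuous : continuous mixture.
Proof.
apply: DMC_continuous => p.
rewrite (funext (fun t => transition_mixture t p)) => t.
apply: cvgD; apply: cvgMr_tmp; last exact: clamp_continuous.
by apply: cvgB; [exact: cvg_cst|exact: clamp_continuous].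
Qed.

End Mixture.

(** The path is the projection of the segment joining two representatives. *)
Lemma DMCo_path_connected (X Y : finType) : path_connected R (DMCo R X Y).
Proof.
move=> a b; exists (fun t => \pi_(DMCo R X Y) (mixture (repr a) (repr b) t)).
split; [|by rewrite mixture0 reprK|by rewrite mixture1 reprK].
apply: continuous_subspaceT => t.
apply: (@continuous_comp R (DMC R X Y) (DMCo R X Y)).
  exact: mixture_continuous.
exact: pi_continuous.
Qed.

End Channels.

Theorem theorem3 (R : realType) (X Y : finType)
    (X_gt0 : 0 < #|X|) (Y_gt0 : 0 < #|Y|) :
  [/\ compact [set: DMCo R X Y],
      path_connected R (DMCo R X Y) &
      metrizable R (DMCo R X Y)].
Proof.
split; [exact: DMCo_compact|exact: DMCo_path_connected|exact: DMCo_metrizable].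
Qed.
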